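(* Let $V$ be a finite-dimensional $\mathbb{C}$-vector space and let $\mathcal{A}$ be an essential hyperplane arrangement in $V$. (1) If $P \in \mathrm{GL}(V)$ satisfies $P(H) \subset H$ for all $H \in \mathcal{A}$, then $P$ is semisimple. (2) If $\mathcal{A}$ is the reflection arrangement of a finite complex reflection group in $\mathrm{GL}(V)$, then the pair $(\mathcal{A},d)$ determines the group; that is, if $W_1, W_2 \subset \mathrm{GL}(V)$ are two finite complex reflection groups which both have $\mathcal{A}$ as reflection arrangement and which have the same function $d : \mathcal{A} \to \mathbb{Z}$, then $W_1 = W_2$.
   Context: A hyperplane arrangement in $V$ is a finite collection of linear hyperplanes of $V$; it is essential if the intersection of all its members is $\{0\}$. A (pseudo-)reflection is an element $s \in \mathrm{GL}(V)$ of finite order such that $\mathrm{Ker}(s-1)$ is a hyperplane. A finite complex reflection group is a finite subgroup $W \subset \mathrm{GL}(V)$ generated by reflections; its reflection arrangement is the set of hyperplanes $\mathrm{Ker}(s-1)$ for $s$ a reflection in $W$. The function $d : \mathcal{A} \to \mathbb{Z}$, $H \mapsto d_H$, associates to $H$ the order of the subgroup of $W$ fixing $H$ pointwise. *)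

(* Defs.v *)
From HB Require Import structures.
From mathcomp Require Import all_boot all_order all_algebra.
From mathcomp Require Import finmap complex.
From mathcomp Require Import classical_sets reals.

Set Implicit Arguments.
Unset Strict Implicit.
Unset Printing Implicit Defensive.

Import GRing.Theory.
Local Open Scope ring_scope.

Section GeneralLinear.
Variables (K : fieldType) (V : vectType K).

(* In finite dimension, an endomorphism is invertible iff its kernel is zero. *)
Record GLvect : predArgType := MkGLvect {
  lfun_of_GL :> 'End(V);
  lfun_of_GLP : lker lfun_of_GL == 0%VS
}.

HB.instance Definition _ := [isSub for lfun_of_GL].
HB.instance Definition _ := [Choice of GLvect by <:].

Fact GLvect_one_subproof : lker (\1%VF : 'End(V)) == 0%VS.
Proof. by apply/lker0P => u v; rewrite !lfunE. Qed.

Fact GLvect_mul_subproof (f g : GLvect) : lker (f \o g)%VF == 0%VS.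
Proof.
apply/lker0P => u v; rewrite !lfunE /=.
by move=> /(lker0P (lfun_of_GLP f)) /(lker0P (lfun_of_GLP g)).
Qed.

Fact GLvect_inv_subproof (f : GLvect) : lker (f^-1)%VF == 0%VS.
Proof. by apply/lker0P/(can_inj (lker0_lfunVK (lfun_of_GLP f))). Qed.

Definition GLvect_one := MkGLvect GLvect_one_subproof.
Definition GLvect_mul (f g : GLvect) := MkGLvect (GLvect_mul_subproof f g).
Definition GLvect_inv (f : GLvect) := MkGLvect (GLvect_inv_subproof f).

Fact GLvect_mulA : associative GLvect_mul.
Proof. by move=> f g h; apply/val_inj/comp_lfunA. Qed.

Fact GLvect_mul1 : left_id GLvect_one GLvect_mul.
Proof. by move=> f; apply/val_inj/comp_lfun1l. Qed.

Fact GLvect_mulr1 : right_id GLvect_one GLvect_mul.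
Proof. by move=> f; apply/val_inj/comp_lfun1r. Qed.

Fact GLvect_mulV : left_inverse GLvect_one GLvect_inv GLvect_mul.
Proof. by move=> f; apply/val_inj/lker0_compVf/lfun_of_GLP. Qed.

Fact GLvect_mulrV : right_inverse GLvect_one GLvect_inv GLvect_mul.
Proof. by move=> f; apply/val_inj/lker0_compfV/lfun_of_GLP. Qed.

HB.instance Definition _ :=
  isGroup.Build GLvect GLvect_mulA GLvect_mul1 GLvect_mulr1 GLvect_mulV GLvect_mulrV.

End GeneralLinear.

Section Arrangements.
Variables (K : fieldType) (V : vectType K).
Implicit Types (H : {vspace V}) (A : {fset {vspace V}}).
Implicit Types (s : GLvect V) (W : {fset (GLvect V)}).

Definition hyperplane H : bool := (\dim H).+1 == \dim {:V}.

Definition hyperplane_arrangement A : Prop :=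
  forall H, H \in A -> hyperplane H.

Definition essential A : Prop :=
  (\bigcap_(H <- enum_fset A) H)%VS = 0%VS.

Definition semisimple (f : 'End(V)) : Prop :=
  forall U : {vspace V}, (f @: U <= U)%VS ->
  exists U' : {vspace V},
    [/\ (f @: U' <= U')%VS, (U + U')%VS = fullv & (U :&: U')%VS = 0%VS].

Definition reflection s : Prop :=
  (exists n : nat, (0 < n)%N /\ (s ^+ n)%g = 1%g) /\
  hyperplane (fixedSpace s).

Definition finite_reflection_group W : Prop :=
  group_closed [in W] /\
  exists S : set (GLvect V),
    (forall s, S s -> reflection s) /\
    [set` W]%classic =
      smallest (fun M : set (GLvect V) => group_closed [in M]) S.

Definition is_reflection_arrangement W A : Prop :=
  forall H, H \in A <->
    exists s, [/\ s \in W, reflection s & H = fixedSpace s].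

Definition fixator_order W H : nat :=
  #|` [fset w in W | (H <= fixedSpace w)%VS] |%fset.

End Arrangements.

(* Main.v *)
(** (1) A P-stable complement of a P-stable subspace can be cut out as an
    intersection of members of the arrangement.
    (2) The fixator of H in W acts on the line V / H through a character chi.
    Two elements with the same chi, even taken from two groups W1 and W2 with
    the same arrangement, differ by a transvection that permutes the finite
    essential arrangement, so they are equal. Hence chi identifies the fixator
    of H in each Wi with a finite group of scalars of order d_H, which can only
    be the group of all d_H-th roots of unity; the fixators in W1 and W2
    coincide, and they contain the generating reflections. *)

Require Import Defs.
From mathcomp Require Import all_boot all_order all_algebra.
From mathcomp Require Import finmap complex.
From mathcomp Require Import classical_sets reals.

Set Implicit Arguments.
Unset Strict Implicit.
Unset Printing Implicit Defensive.

Import GRing.Theory.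
Local Open Scope ring_scope.

(** * Stable complements and semisimplicity *)

Lemma hyperplane_addv (K : fieldType) (V : vectType K) (H U : {vspace V}) :
  hyperplane H -> ~~ (U <= H)%VS -> (U + H)%VS = fullv.
Proof.
move=> /eqP dimH nUH; apply/eqP; rewrite eqEdim subvf /= -dimH.
rewrite ltnNge (geq_leqif (dimv_leqif_sup (addvSr U H))).
by apply: contra nUH => /(subv_trans (addvSl U H)).
Qed.

Lemma essential_capv (K : fieldType) (V : vectType K)
    (A : {fset {vspace V}}) (U : {vspace V}) :
  essential A -> (forall H, H \in A -> (U <= H)%VS) -> U = 0%VS.
Proof.
rewrite /essential => ess sUA; apply/eqP; rewrite -subv0 -ess.
rewrite big_seq; apply: (big_ind (fun U' => U <= U')%VS).
- exact: subvf.
- by move=> U1 U2 s1 s2; rewrite subv_cap s1.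
- by move=> H AH; apply: sUA.
Qed.

(* Cut fullv by the members of A one after the other, as long as the sum with
   U remains full: by the modular law, a hyperplane that is refused contains
   the intersection of U with the current subspace. *)
Lemma stable_complement (K : fieldType) (V : vectType K) (P : 'End(V))
    (U : {vspace V}) (s : seq {vspace V}) :
  {in s, forall H, hyperplane H /\ (P @: H <= H)%VS} ->
  exists U' : {vspace V},
    [/\ (P @: U' <= U')%VS, (U + U')%VS = fullv &
        {in s, forall H, (U :&: U' <= H)%VS}].
Proof.
elim: s => [|H s IHs] Ps; first by exists fullv; rewrite subvf addvf.
have [|U' [PU' UU' sU']] := IHs.
  by move=> H1 sH1; apply: Ps; rewrite inE sH1 orbT.
have [hypH PH] : hyperplane H /\ (P @: H <= H)%VS.
  by apply: Ps; rewrite inE eqxx.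
have [full|nfull] := eqVneq (U + U' :&: H)%VS fullv.
  exists (U' :&: H)%VS; split=> // [|H1].
    by rewrite (subv_trans (limg_cap _ _ _)) // capvS.
  rewrite inE capvA => /predU1P[->|sH1]; first exact: capvSr.
  exact: subv_trans (capvSl _ _) (sU' _ sH1).
exists U'; split=> // H1; rewrite inE => /predU1P[->|/sU' //].
apply: contraNT nfull => /(hyperplane_addv hypH) eqf.
have eqU' : U' = (U :&: U' + H :&: U')%VS.
  by rewrite vspace_modl ?capvSr // eqf capfv.
rewrite -UU' [in X in _ == X]eqU' addvA.
have /addv_idPl -> := capvSl U U'.
by rewrite (capvC H).
Qed.

(** The complement cut out by the members of [A] meets [U] inside each of them, hence in zero by
    essentiality. *)
Lemma stabilizer_semisimple (K : fieldType) (V : vectType K)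
    (A : {fset {vspace V}}) (P : 'End(V)) :
  hyperplane_arrangement A -> essential A ->
  (forall H, H \in A -> (P @: H <= H)%VS) -> semisimple P.
Proof.
move=> hypA ess PA U _.
have [|U' [PU' UU' sU']] := @stable_complement K V P U (enum_fset A).
  by move=> H AH; split; [exact: hypA | exact: PA].
exists U'; split=> //; exact: (essential_capv ess sU').
Qed.

(** * Linear forms and transvections *)

(** Any [v] outside [H] spans a complement of [H]; [phi] is the coordinate of the projection onto
    that line along [H]. *)
Lemma hyperplane_lker (K : fieldType) (V : vectType K) (H : {vspace V}) :
  hyperplane H ->
  exists (phi : 'Hom(V, K^o)) (v : V), lker phi = H /\ phi v = 1.
Proof.
move=> hypH.
have /subvPn[v _ nHv] : ~~ (fullv <= H)%VS.
  by apply/negP => /dimvS; rewrite -(eqP hypH) ltnn.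
have v0 : v != 0 by apply: contraNneq nHv => ->; exact: mem0v.
have full : (<[v]> + H)%VS = fullv by apply: hyperplane_addv.
have cap : (<[v]> :&: H)%VS = 0%VS.
  apply/eqP; rewrite -subv0; apply/subvP => x /memv_capP[/vlineP[k ->]].
  have [->|k0] := eqVneq k 0; first by rewrite scale0r !mem0v.
  by rewrite rpredZeq (negPf k0) (negPf nHv).
pose X := [tuple v].
have freeX : free X by rewrite /= seq1_free.
pose phi : 'Hom(V, K^o) := (linfun (coord X ord0 : V -> K^o) \o daddv_pi <[v]> H)%VF.
have phiE x : daddv_pi <[v]> H x = phi x *: v.
  have /vlineP[k kE] := memv_pi <[v]> H x.
  rewrite comp_lfunE lfunE /= kE linearZ /=.
  by have /= -> := coord_free ord0 ord0 freeX; rewrite mulr1.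
exists phi, v; split.
  apply/vspaceP => x; rewrite memv_ker; apply/eqP/idP => [phix|Hx].
    have := daddv_pi_add cap (_ : x \in _); rewrite full memvf => /(_ isT) <-.
    by rewrite phiE phix scale0r add0r memv_pi.
  have := daddv_pi_add cap (_ : x \in _); rewrite full memvf => /(_ isT).
  rewrite (daddv_pi_id _ Hx) 1?capvC // => /(canRL (addrK _)).
  rewrite subrr phiE => /eqP; rewrite scaler_eq0 (negPf v0) orbF => /eqP //.
have := phiE v; rewrite daddv_pi_id ?memv_line // -{1}[v]scale1r => /eqP.
by rewrite -subr_eq0 -scalerBl scaler_eq0 (negPf v0) orbF subr_eq0 => /eqP.
Qed.

(** The vector [x - phi x *: v] lies in [lker phi], so [f] fixes it. *)
Lemma fix_lkerE (K : fieldType) (V : vectType K) (f : 'End(V))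
    (phi : 'Hom(V, K^o)) (v x : V) :
  (lker phi <= fixedSpace f)%VS -> phi v = 1 ->
  f x = x + phi x *: (f v - v).
Proof.
move=> /fixedSpacesP fix_f phiv.
have : f (x - phi x *: v) = x - phi x *: v.
  apply: fix_f; rewrite memv_ker linearB linearZ /= phiv.
  by rewrite -[_ *: 1]/(_ * 1) mulr1 subrr.
rewrite linearB linearZ /= => /(canRL (subrK _)) ->.
by rewrite scalerBr addrAC addrA.
Qed.

(* P^k x = x + k phi(x) h with h = P v - v.  If h != 0, some H' in A does not
   contain h; as P permutes the finite set A, P^k maps H' to itself for some
   k > 0, which forces H' = H, although h belongs to H. *)
Lemma transvection_trivial (K : numFieldType) (V : vectType K)
    (A : {fset {vspace V}}) (P : GLvect V) (phi : 'Hom(V, K^o)) (v : V) :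
  hyperplane_arrangement A -> essential A -> hyperplane (lker phi) ->
  (forall H, H \in A -> (P @: H)%VS \in A) ->
  (lker phi <= fixedSpace P)%VS ->
  phi v = 1 -> phi (P v) = 1 -> P = 1%g.
Proof.
move=> hypA ess hypH PA fixP phiv phiPv.
pose h := P v - v.
have phih : phi h = 0 by rewrite linearB /= phiv phiPv subrr.
have PE x : P x = x + phi x *: h by apply: fix_lkerE.
have [h0|nh0] := eqVneq h 0.
  apply/val_inj/lfunP => x; rewrite /= PE h0 scaler0 addr0.
  by rewrite lfunE.
have [H' AH' nH'h] : exists2 H', H' \in A & h \notin H'.
  case: (boolP (has (fun H' : {vspace V} => h \notin H') (enum_fset A))) => [/hasP[]|].
    by move=> H' AH' nH'h; exists H'.
  rewrite -all_predC => /allP all_h.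
  have /eqP : <[h]>%VS = 0%VS.
    by apply: (essential_capv ess) => H' /all_h /=; rewrite negbK -memvE.
  by rewrite -dimv_eq0 dim_vline nh0.
pose f (H : A) : A := [` PA _ (valP H)]%fset.
have inj_f : injective f.
  move=> H1 H2 /(congr1 val) /= /(congr1 (fun U => P^-1 @: U)%VS).
  rewrite -!limg_comp (lker0_compVf (lfun_of_GLP P)) !lim1g.
  exact: val_inj.
(* Injectivity of [f] on the finite type [A] puts [H'] on a cycle, of length [n]. *)
pose n := order f [` AH']%fset.
have iterE m (H : A) x : x \in val H ->
    x + (m%:R * phi x) *: h \in val (iter m f H).
  elim: m => [|m IHm] Hx; first by rewrite mul0r scale0r addr0.
  rewrite iterS /=; apply/memv_imgP; exists (x + (m%:R * phi x) *: h).
    exact: IHm.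
  have -> : P (x + (m%:R * phi x) *: h) = x + (m%:R * phi x) *: h + phi x *: h.
    rewrite PE; congr (_ + _ *: _).
    by rewrite linearD linearZ /= phih scaler0 addr0.
  by rewrite -addrA -scalerDl -natr1 mulrDl mul1r.
(* Both [x] and [x + (n%:R * phi x) *: h] lie in [H'] while [h] does not, so [n%:R * phi x] is zero;
   conclude in characteristic zero. *)
have H'0 x : x \in H' -> phi x = 0.
  move=> H'x; have := iterE n [` AH']%fset x H'x.
  rewrite iter_order //= rpredDl // rpredZeq (negPf nH'h) orbF.
  rewrite mulf_eq0 Num.Theory.pnatr_eq0 => /orP[|/eqP //].
  by rewrite eqn0Ngt order_gt0.
case/negP: nH'h.
have sH : (H' <= lker phi)%VS.
  by apply/subvP => x /H'0; rewrite memv_ker => ->.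
have /eqP -> : H' == lker phi.
  by rewrite eqEdim sH /= -ltnS (eqP hypH) -(eqP (hypA _ AH')).
by rewrite memv_ker phih.
Qed.

(** Multiplication by [x] permutes [s]; compare the product of the entries before and after, and
    cancel it. *)
Lemma stable_seq_unity (F : fieldType) (s : seq F) (x : F) :
  uniq s -> {in s, forall y, y != 0} -> x != 0 ->
  {in s, forall y, x * y \in s} -> x ^+ size s = 1.
Proof.
move=> us s0 x0 sxs.
have inj : injective ( *%R x) by apply: mulfI.
have perm : perm_eq (map ( *%R x) s) s.
  have um : uniq (map ( *%R x) s) by rewrite map_inj_uniq.
  have sub : {subset map ( *%R x) s <= s} by move=> _ /mapP[y /sxs ? ->].
  by apply: uniq_perm => //; apply: (uniq_min_size um sub _).2; rewrite size_map.
have := perm_big _ perm : \prod_(y <- _) y = \prod_(y <- s) y.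
rewrite big_map big_split /= big_const_seq count_predT iter_mulr_1.
have p0 : \prod_(y <- s) y != 0.
  by rewrite prodf_seq_neq0; apply/allP => y /s0.
by move/(canRL (mulfK p0)); rewrite divff.
Qed.

(** * Reflection groups with a common arrangement *)

Section ReflectionGroups.
Variables (K : numFieldType) (V : vectType K) (A : {fset {vspace V}}).
Hypotheses (hypA : hyperplane_arrangement A) (ess : essential A).
Implicit Type W : {fset (GLvect V)}.

Lemma limg_fixedSpaceJ (w s : GLvect V) :
  (w @: fixedSpace s)%VS = fixedSpace (w * s * w^-1)%g.
Proof.
apply/vspaceP => x; apply/memv_imgP/fixedSpaceP => [[y /fixedSpaceP sy ->]|].
  by rewrite !lfunE /= lfunE /= (lker0_lfunK (lfun_of_GLP w)) sy.
rewrite !lfunE /= lfunE /= => wx; exists (w^-1%VF x).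
  by apply/fixedSpaceP/(lker0P (lfun_of_GLP w)); rewrite wx
     (lker0_lfunVK (lfun_of_GLP w)).
by rewrite (lker0_lfunVK (lfun_of_GLP w)).
Qed.

(** If [s] is a reflection in [W] with hyperplane [H], its conjugate by [w] is one with hyperplane
    [w @: H]. *)
Lemma limg_arrangement W (w : GLvect V) (H : {vspace V}) :
  group_closed [in W] -> is_reflection_arrangement W A ->
  w \in W -> H \in A -> (w @: H)%VS \in A.
Proof.
move=> [W1 WD] WA Ww /[dup] AH /WA[s [Ws [[n [n0 sn]] hyps] HE]].
have WV u : u \in W -> (u^-1)%g \in W.
  by move=> Wu; have := WD _ _ W1 Wu; rewrite div1g.
have WM u u' : u \in W -> u' \in W -> (u * u')%g \in W.
  by move=> Wu Wu'; have := WD _ _ Wu (WV _ Wu'); rewrite invgK.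
apply/WA; exists (w * s * w^-1)%g; split.
- by rewrite !WM ?WV.
- split.
    exists n; split=> //.
    have -> : (w * s * w^-1 = s ^ w^-1)%g by rewrite /conjg invgK mulgA.
    by rewrite -conjXg sn conj1g.
  rewrite -limg_fixedSpaceJ /hyperplane limg_dim_eq //.
  by rewrite (eqP (lfun_of_GLP w)) capv0.
- by rewrite HE limg_fixedSpaceJ.
Qed.

Lemma reflection_group_sub W1 W2 :
  finite_reflection_group W1 -> finite_reflection_group W2 ->
  is_reflection_arrangement W1 A -> is_reflection_arrangement W2 A ->
  (forall H, H \in A -> fixator_order W1 H = fixator_order W2 H) ->
  {subset W1 <= W2}.
Proof.
move=> [gW1 [S [Srefl W1E]]] [gW2 _] W1A W2A eqd.
(* [W1] is the smallest closed set containing [S], and [W2] is closed. *)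
suff sSW2 : (S `<=` [set` W2])%classic.
  move=> w W1w.
  have : ([set` W1] w)%classic by [].
  rewrite W1E => /(_ [set` W2]%classic); apply; split=> //.
  by split=> [|u u']; rewrite !mem_setE; [exact: gW2.1 | exact: gW2.2].
move=> s Ss /=.
have W1s : s \in W1.
  by have : ([set` W1] s)%classic by rewrite W1E; apply: sub_gen_smallest.
have refs := Srefl _ Ss.
pose H := fixedSpace s.
have AH : H \in A by apply/W1A; exists s.
have [phi [v [kerphi phiv]]] := hyperplane_lker (hypA AH).
pose fixator W := [fset w in W | (H <= fixedSpace w)%VS]%fset.
(* [chi w] is the eigenvalue of [w] on [V / H]. *)
pose chi (w : GLvect V) : K := phi (w v).
pose X W := map chi (enum_fset (fixator W)).
have fixE W w : w \in fixator W = (w \in W) && (H <= fixedSpace w)%VS.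
  by rewrite !inE.
(* Expand [w (w' v)] by [fix_lkerE] and apply [phi]. *)
have chiM (w w' : GLvect V) : (H <= fixedSpace w)%VS ->
    chi (w * w')%g = chi w * chi w'.
  rewrite -kerphi /chi lfunE /= => fixw; rewrite (fix_lkerE _ fixw phiv).
  rewrite linearD linearZ linearB /= phiv -[_ *: _]/(_ * _) mulrBr mulr1.
  by rewrite addrC subrK mulrC.
have chi1 : chi 1%g = 1 by rewrite /chi lfunE.
have fixM (w w' : GLvect V) : (H <= fixedSpace w)%VS -> (H <= fixedSpace w')%VS ->
    (H <= fixedSpace (w * w')%g)%VS.
  move=> /fixedSpacesP fw /fixedSpacesP fw'.
  by apply/fixedSpacesP => x Hx; rewrite lfunE /= fw' // fw.
have fixV (w : GLvect V) : (H <= fixedSpace w)%VS -> (H <= fixedSpace (w^-1)%g)%VS.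
  move=> /fixedSpacesP fw; apply/fixedSpacesP => x Hx.
  by rewrite -{1}[x]fw // (lker0_lfunK (lfun_of_GLP w)).
have chi_neq0 (w : GLvect V) : (H <= fixedSpace w)%VS -> chi w != 0.
  move=> fw; apply/negP => /eqP chiw.
  have := chiM _ (w^-1)%g fw.
  by rewrite mulgV chi1 chiw mul0r => /eqP; rewrite oner_eq0.
(* Used twice: with [W = W'] it shows that [X W] has no repetition, and across [W1] and [W2] it
   identifies [s] with an element of [W2]. *)
have chi_inj W W' w w' : group_closed [in W] -> group_closed [in W'] ->
    is_reflection_arrangement W A -> is_reflection_arrangement W' A ->
    w \in fixator W -> w' \in fixator W' -> chi w = chi w' -> w = w'.
  move=> gW gW' WA W'A; rewrite !fixE => /andP[Ww fw] /andP[W'w' fw'] eqchi.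
  have fwV := fixV _ fw'.
  have W'V : (w'^-1)%g \in W'.
    by have := gW'.2 _ _ gW'.1 W'w'; rewrite div1g.
  suff /(congr1 (fun u => u * w')%g) : (w * w'^-1)%g = 1%g.
    by rewrite -mulgA mulVg mulg1 mul1g.
  apply: (transvection_trivial (phi := phi) (v := v) hypA ess) => //.
  - by rewrite kerphi; apply: hypA.
  - move=> H' AH'; rewrite limg_comp.
    by apply: (limg_arrangement gW) => //; apply: (limg_arrangement gW').
  - by rewrite kerphi fixM.
  - by have := chiM _ (w'^-1)%g fw; rewrite eqchi -chiM // mulgV chi1.
have uniqX W : group_closed [in W] -> is_reflection_arrangement W A ->
    uniq (X W).
  by move=> gW WA; rewrite map_inj_in_uniq ?fset_uniq // => w w'; apply: chi_inj.
have unityX W x : group_closed [in W] -> is_reflection_arrangement W A ->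
    x \in X W -> x ^+ size (X W) = 1.
  move=> gW WA /mapP[w]; rewrite fixE => /andP[Ww fw] ->.
  apply: stable_seq_unity; rewrite ?uniqX ?chi_neq0 //.
    by move=> y /mapP[w']; rewrite fixE => /andP[_ fw'] ->; apply: chi_neq0.
  move=> y /mapP[w']; rewrite fixE => /andP[Ww' fw'] ->; rewrite -chiM //.
  apply: map_f; rewrite fixE fixM // andbT.
  by have := gW.2 _ _ Ww (gW.2 _ _ gW.1 Ww'); rewrite div1g invgK.
have sizeX W : size (X W) = fixator_order W H by rewrite size_map.
have fixs : s \in fixator W1 by rewrite fixE W1s subvv.
have X1s : chi s \in X W1 by apply: map_f.
have d_gt0 : (0 < size (X W2))%N.
  by rewrite sizeX -eqd // -sizeX; case: (X W1) X1s.
have [|nX2s] := boolP (chi s \in X W2).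
  move=> /mapP[s2 fixs2] /(chi_inj _ _ _ _ gW1 gW2 W1A W2A fixs fixs2) ->.
  by move: fixs2; rewrite fixE => /andP[].
(* Otherwise, with [d] the common order of the fixators, [chi s] and the entries of [X W2] would be
   [d + 1] distinct [d]-th roots of unity. *)
suff : (size (chi s :: X W2) <= size (X W2))%N by rewrite /= ltnn.
apply: max_unity_roots => //; last by rewrite /= nX2s uniqX.
apply/allP => x; rewrite inE unity_rootE => /predU1P[->|X2x].
  by rewrite sizeX -eqd // -sizeX unityX.
by rewrite unityX.
Qed.

End ReflectionGroups.

Theorem proposition2p1 (R : realType) (V : vectType R[i])
    (A : {fset {vspace V}})
    (hA : hyperplane_arrangement A) (hess : essential A) :
  (forall P : GLvect V,
     (forall H : {vspace V}, H \in A -> (P @: H <= H)%VS) ->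
     semisimple P)
  /\
  (forall W1 W2 : {fset (GLvect V)},
     finite_reflection_group W1 -> finite_reflection_group W2 ->
     is_reflection_arrangement W1 A -> is_reflection_arrangement W2 A ->
     (forall H : {vspace V}, H \in A ->
        fixator_order W1 H = fixator_order W2 H) ->
     W1 = W2).
Proof.
split=> [P|W1 W2 rW1 rW2 W1A W2A eqd]; first exact: stabilizer_semisimple.
apply/fsetP => w; apply/idP/idP; first exact: (reflection_group_sub hA hess).
by apply: (reflection_group_sub hA hess) => // H /eqd.
Qed.
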